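(* Let $\mathcal{D}=(\Omega,\mathcal{B})$ be a supersimple $2$-$(n,4,\lambda)$ design with $n>2\lambda+2$, and let $\mathcal{C}$ denote the set of all collinear triples of elements of $\Omega$. Let $\infty\in\Omega$ and define $G:=\mathcal{L}_\infty(\mathcal{D})$. Then: (a) if $G$ is a group, then $G$ is primitive on $\Omega$; (b) if $(\Omega,\mathcal{C})$ is a regular two-graph, then $\pi_\infty(\mathcal{D})$ is transitive on $\Omega\setminus\{\infty\}$; (c) if $(\Omega,\mathcal{C})$ is a regular two-graph and $G$ is a group, then $\pi_\infty(\mathcal{D})$ is primitive on $\Omega\setminus\{\infty\}$.
   Context: A $2$-$(n,4,\lambda)$ design $(\Omega,\mathcal{B})$ consists of a set $\Omega$ of $n$ points and a multiset $\mathcal{B}$ of $4$-subsets of $\Omega$ (lines) such that every $2$-subset of $\Omega$ lies in exactly $\lambda$ lines; it is supersimple if any two distinct lines meet in at most two points. For distinct $a,b\in\Omega$ there are $\lambda$ lines $\{a,b,a_i,b_i\}$ ($1\le i\le\lambda$) through $a,b$, and the points $a_1,\dots,a_\lambda,b_1,\dots,b_\lambda$ are pairwise distinct; the elementary move is $[a,b]:=(a,b)\prod_{i=1}^{\lambda}(a_i,b_i)\in\operatorname{Sym}(\Omega)$, and $[a,a]:=1$. Permutations act on the right and products are composed left to right. For $a_0,\dots,a_k\in\Omega$ the move sequence is $[a_0,a_1,\dots,a_k]:=[a_0,a_1][a_1,a_2]\cdots[a_{k-1},a_k]$. For $\infty\in\Omega$, $\mathcal{L}_\infty(\mathcal{D})$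 is the set of all move sequences $[\infty,a_1,\dots,a_k]$ ($k\ge1$) starting at $\infty$ (the Conway groupoid), and $\pi_\infty(\mathcal{D})$ is the set of all move sequences $[\infty,a_1,\dots,a_{k-1},\infty]$ starting and ending at $\infty$ (a subgroup of $\operatorname{Sym}(\Omega\setminus\{\infty\})$). A collinear triple is a $3$-subset of $\Omega$ contained in some line. A $2$-$(n,3,\mu)$ design $(\Omega,\mathcal{C})$ is a regular two-graph if every $4$-subset of $\Omega$ contains exactly $0$, $2$ or $4$ of the members of $\mathcal{C}$. *)

(* Defs.v *)
From mathcomp Require Import all_boot all_fingroup.
From mathcomp Require Import primitive_action.
From mathcomp Require boolp.
Set Implicit Arguments. Unset Strict Implicit. Unset Printing Implicit Defensive.
Local Open Scope group_scope.

Section Designs.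
Variable T : finType.

(* A 2-(n,4,lam) design on the point set T (n = #|T|): the lines form a
   multiset, represented as a sequence of 4-subsets of T. *)
Definition is_2design4 (blocks : seq {set T}) (lam : nat) : Prop :=
  (forall B, B \in blocks -> #|B| = 4) /\
  (forall a b : T, a != b -> count (fun B : {set T} => (a \in B) && (b \in B)) blocks = lam).

(* supersimple: any two distinct lines (distinct members of the multiset)
   meet in at most two points *)
Definition supersimple (blocks : seq {set T}) : Prop :=
  forall i j, i < size blocks -> j < size blocks -> i != j ->
    #|nth set0 blocks i :&: nth set0 blocks j| <= 2.

Definition other_pair_perm (L : {set T}) (a b : T) : {perm T} :=
  let S := L :\ a :\ b in
  match [pick x in S] with
  | Some x => match [pick y in S :\ x] with
              | Some y => tperm x y
              | None => 1
              end
  | None => 1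
  end.

(* elementary move [a,b] = (a,b) * prod_i (a_i,b_i); [a,a] = 1.
   In mathcomp, (s * t) x = t (s x): products are composed left to right. *)
Definition elem_move (blocks : seq {set T}) (a b : T) : {perm T} :=
  if a == b then 1 else
  tperm a b * \prod_(L <- blocks | (a \in L) && (b \in L)) other_pair_perm L a b.

Fixpoint move_seq (blocks : seq {set T}) (a0 : T) (s : seq T) : {perm T} :=
  match s with
  | [::] => 1
  | a1 :: s' => elem_move blocks a0 a1 * move_seq blocks a1 s'
  end.

Definition conway_groupoid (blocks : seq {set T}) (inf : T) : {set {perm T}} :=
  [set g : {perm T} | boolp.asbool (exists s : seq T, 0 < size s /\ g = move_seq blocks inf s)].

Definition pi_inf (blocks : seq {set T}) (inf : T) : {set {perm T}} :=
  [set g : {perm T} | boolp.asbool (exists s : seq T, g = move_seq blocks inf (rcons s inf))].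

Definition is_group_set (G : {set {perm T}}) : Prop :=
  (1 \in G) /\ (forall g h, g \in G -> h \in G -> g * h \in G) /\
  (forall g, g \in G -> g^-1 \in G).

Definition collinear_triples (blocks : seq {set T}) : {set {set T}} :=
  [set X : {set T} | (#|X| == 3) && has (fun B : {set T} => X \subset B) blocks].

Definition regular_two_graph (C : {set {set T}}) : Prop :=
  (forall X, X \in C -> #|X| = 3) /\
  (exists mu : nat, forall a b : T, a != b ->
      #|[set X in C | (a \in X) && (b \in X)]| = mu) /\
  (forall Y : {set T}, #|Y| = 4 ->
      #|[set X in C | X \subset Y]| \in [:: 0; 2; 4]).
End Designs.

(* Main.v *)
Require Import Defs.
From mathcomp Require Import all_boot all_fingroup.
From mathcomp Require Import primitive_action.
From mathcomp Require boolp.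
From mathcomp Require Import zify.
Set Implicit Arguments.
Unset Strict Implicit.
Unset Printing Implicit Defensive.
Local Open Scope group_scope.

(* Write f for the indicator function of the collinear triples.  Apart from
   swapping a and b, the move [a,b] moves exactly the points x with
   f(a, b, x) = 1, so it has n - 2 lam - 2 > 0 fixed points.
   (a) G is a group containing all elementary moves.  Given a block system with
   d, e in a block D, the move [d,e] only fixes points of D other than d.  Take
   a outside D and b fixed by [d,a]; then a, b and d lie in distinct blocks and
   [a,b] fixes D pointwise, so it has more fixed points than [d,e].
   (b) The two-graph condition says that f is a cocycle modulo 2, and since
   n > 2 lam + 2 a count shows that every collinear triple {oo, x, y} admits a
   point z with f(oo, x, z) = f(oo, z, y) = 0.  If f(oo, x, y) = 0, then z = x
   has the same property.  In both cases [oo,x,z,y,oo] maps x to y.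
   (c) Given a block system, (b) provides a, b in distinct blocks with
   f(oo, a, b) = 0.  Suppose that the block of a has another point c, and let
   d be the image of c under [a,b], which lies in the block of b.  The cocycle
   identity and the count of (b) yield f(oo, a, c) = f(oo, b, d) = 0, and then
   the loop [oo,a,d,oo] fixes d and maps b to c, although d and b are in the
   same block while d and c are not. *)

Section Congruences.
Variables (aT : finGroupType) (sT : finType).
Variables (A : {set aT}) (S : {set sT}) (to : {action aT &-> sT}).

Definition congruence_on (rT : Type) (h : sT -> rT) : Prop :=
  {in A, forall g, {in S &, forall x y, h x = h y -> h (to x g) = h (to y g)}}.

Lemma imprimitivity_pblock_congruence Q :
  imprimitivity_system A S to Q -> congruence_on (pblock Q).
Proof.
case/and3P=> /and3P[/eqP covQ tiQ _] actQ _ g Ag x y Sx Sy eqxy.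
have Qx : pblock Q x \in Q by rewrite pblock_mem ?covQ.
have Qxg : to^*%act (pblock Q x) g \in Q by rewrite (acts_act actQ).
have pblock_to z :
    z \in pblock Q x -> pblock Q (to z g) = to^*%act (pblock Q x) g.
  by move=> xz; apply: def_pblock => //; apply: imset_f.
by rewrite !pblock_to // ?mem_pblock ?covQ // eqxy mem_pblock covQ.
Qed.

Lemma imset_pblock (Q : {set {set sT}}) : partition Q S -> pblock Q @: S = Q.
Proof.
case/and3P=> /eqP covQ tiQ nzQ; apply/setP=> B; apply/imsetP/idP.
  by case=> x Sx ->; rewrite pblock_mem ?covQ.
move=> QB; have /set0Pn[x Bx] : B != set0 by apply: contraNneq nzQ => <-.
exists x; last by rewrite (def_pblock tiQ QB Bx).
by rewrite -covQ; apply/bigcupP; exists B.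
Qed.

Lemma primitive_congruence :
  [transitive A, on S | to] ->
  (forall h : sT -> {set sT}, congruence_on h ->
     {in S &, forall x y, x != y -> h x = h y ->
        {in S, forall z, h z = h x}}) ->
  [primitive A, on S | to].
Proof.
move=> trA const; rewrite /primitive trA; apply/existsP=> -[Q sysQ].
have [partQ _ /andP[Q_gt1 ltQS]] := and3P sysQ.
have /dinjectivePn[x Sx [y /andP[/= neqyx Sy] eqxy]] :
    ~~ dinjectiveb (pblock Q) S.
  apply: contraL ltQS => /dinjectiveP/card_in_imset.
  by rewrite imset_pblock // -leqNgt => ->.
have neqxy : x != y by rewrite eq_sym.
have constQ :=
  const _ (imprimitivity_pblock_congruence sysQ) x y Sx Sy neqxy eqxy.
move: Q_gt1; rewrite ltnNge -{1}(imset_pblock partQ) -(cards1 (pblock Q x)).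
case/negP; apply/subset_leq_card/subsetP=> _ /imsetP[z Sz ->].
by rewrite inE constQ.
Qed.

End Congruences.

Section PermProducts.
Variables (T : finType) (I : eqType) (P : pred I) (F : I -> {perm T}).

Lemma prod_perm_fix (r : seq I) x :
  (forall i, i \in r -> P i -> F i x = x) -> (\prod_(i <- r | P i) F i) x = x.
Proof.
rewrite big_seq_cond => fixx; elim/big_ind: _ => [|s t sx tx|i /andP[ri Pi]].
- by rewrite perm1.
- by rewrite permM sx.
- exact: fixx.
Qed.

Lemma prod_perm_single (r : seq I) i x :
  uniq r -> i \in r -> P i ->
  (forall j, j \in r -> P j -> j != i -> F j x = x /\ F j (F i x) = F i x) ->
  (\prod_(j <- r | P j) F j) x = F i x.
Proof.
move=> uniq_r /splitPr r_split; case: r_split uniq_r => r1 r2.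
rewrite uniq_catC /= mem_cat orbC -mem_cat => /andP[notin_i _] Pi fix_others.
have others j : j \in r1 ++ r2 -> P j -> F j x = x /\ F j (F i x) = F i x.
  move=> rj Pj; apply: fix_others => //; last first.
    by apply: contraNneq notin_i => <-.
  by rewrite mem_cat inE orbCA -mem_cat rj orbT.
have fix_r1 : (\prod_(j <- r1 | P j) F j) x = x.
  apply: prod_perm_fix => j rj Pj.
  by have [] := others j _ Pj; rewrite ?mem_cat ?rj.
rewrite big_cat big_cons Pi !permM fix_r1; apply: prod_perm_fix => j rj Pj.
by have [] := others j _ Pj; rewrite ?mem_cat ?rj ?orbT.
Qed.

End PermProducts.

Section FiniteSets.
Variable T : finType.
Implicit Types (X Y : {set T}) (x y z w : T) (s : seq T).

Lemma set_seq3 x y z : [set:: [:: x; y; z]] = [set x; y; z].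
Proof. by rewrite !set_cons set_nil setU0 !setUA. Qed.

Lemma set_seq4 w x y z : [set:: [:: w; x; y; z]] = [set w; x; y; z].
Proof. by rewrite !set_cons set_nil setU0 !setUA. Qed.

Lemma card_set_seq s : (#|[set:: s]| == size s) = uniq s.
Proof. by rewrite cardsE; apply/eqP/idP=> /card_uniqP. Qed.

Lemma set_seqD1 s x : uniq s -> [set:: s] :\ x = [set:: rem x s].
Proof. by move=> uniq_s; apply/setP=> y; rewrite !inE mem_rem_uniq. Qed.

Lemma cardsD2 X x y :
  x != y -> x \in X -> y \in X -> #|X| = #|X :\ x :\ y|.+2.
Proof.
move=> xy Xx Xy.
by rewrite (cardsD1 x) (cardsD1 y (X :\ x)) Xx !inE eq_sym xy Xy.
Qed.

Lemma subset_card_succ X Y :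
  X \subset Y -> #|Y| = #|X|.+1 -> exists2 y, y \notin X & Y = y |: X.
Proof.
move=> sXY cardY; have /eqP/cards1P[y defy] : #|Y :\: X| = 1%N.
  by rewrite cardsD (setIidPr sXY) cardY subSnn.
have /setDP[_ Xy] : y \in Y :\: X by rewrite defy set11.
by exists y; rewrite // -defy setUC -{1}(setIidPr sXY) setID.
Qed.

Lemma card_facets (C : {set {set T}}) Y k :
  {in C, forall X, #|X| = k} -> #|Y| = k.+1 ->
  #|[set X in C | X \subset Y]| = \sum_(y in Y) (Y :\ y \in C).
Proof.
move=> cardC cardY.
have -> : [set X in C | X \subset Y]
        = (fun y => Y :\ y) @: [set y in Y | Y :\ y \in C].
  apply/setP=> X; apply/setIdP/imsetP=> [[CX sXY]|[y /setIdP[_ CYy] ->]].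
    have [|y Xy defY] := subset_card_succ sXY; first by rewrite cardY cardC.
    by exists y; rewrite defY ?inE ?eqxx setU1K.
  by rewrite subsetDl.
rewrite card_in_imset => [|x y /setIdP[Yx _] _ /setP/(_ x)].
  by rewrite -sum1dep_card big_mkcondr /=; apply: eq_bigr => y _; case: ifP.
by rewrite !in_setD1 eqxx Yx /= andbT => /esym/negbFE/eqP.
Qed.

Lemma sum_card_exchange (I : Type) (r : seq I) (P : pred I)
    (A : I -> {set T}) :
  \sum_(i <- r | P i) #|A i| = \sum_x count (fun i => P i && (x \in A i)) r.
Proof.
under eq_bigr do rewrite -sum1_card big_mkcond.
rewrite exchange_big; apply: eq_bigr => x _.
by rewrite -sum1_count big_mkcondr.
Qed.

End FiniteSets.

Section OtherPair.
Variables (T : finType) (L : {set T}) (a b : T).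

Lemma other_pair_permE x y :
  x != y -> L :\ a :\ b = [set x; y] -> other_pair_perm L a b = tperm x y.
Proof.
move=> xy pair; rewrite /other_pair_perm pair.
case: pickP => [u|/(_ x)]; last by rewrite set21.
case/set2P=> ->.
  rewrite setU1K ?inE //.
  by case: pickP => [v /set1P->//|/(_ y)]; rewrite set11.
rewrite setUC setU1K ?inE 1?eq_sym // tpermC.
by case: pickP => [v /set1P->//|/(_ x)]; rewrite set11.
Qed.

Lemma other_pair_perm_out z :
  #|L :\ a :\ b| = 2 -> z \notin L :\ a :\ b -> other_pair_perm L a b z = z.
Proof.
move/eqP/cards2P=> [x [y [xy pair]]]; rewrite (other_pair_permE xy pair) pair.
by rewrite !inE negb_or ![z == _]eq_sym => /andP[xz yz]; rewrite tpermD.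
Qed.

End OtherPair.

Section Designs.
Variables (T : finType) (blocks : seq {set T}).
Implicit Types (a b c d x y z : T) (K L : {set T}).

Definition collinear x y z : bool :=
  [set x; y; z] \in collinear_triples blocks.

Definition line a b c d : bool := [set a; b; c; d] \in blocks.

Local Notation move := (elem_move blocks).

Lemma collinearE x y z :
  collinear x y z =
    uniq [:: x; y; z] && has (fun L => [set x; y; z] \subset L) blocks.
Proof. by rewrite /collinear inE -set_seq3 card_set_seq. Qed.

Lemma collinear_swap12 x y z : collinear x y z = collinear y x z.
Proof. by rewrite /collinear [[set x; y]]setUC. Qed.

Lemma collinear_swap23 x y z : collinear x y z = collinear x z y.
Proof. by rewrite /collinear setUAC. Qed.

Lemma collinear_rot x y z : collinear x y z = collinear y z x.
Proof. by rewrite collinear_swap12 collinear_swap23. Qed.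

Lemma collinear_neq x y z : collinear x y z -> [/\ x != y, x != z & y != z].
Proof.
rewrite collinearE /= !inE negb_or andbT.
by case/andP=> /andP[/andP[-> ->] ->].
Qed.

Lemma collinear_irr x y :
  (collinear x x y = false) * (collinear x y x = false)
    * (collinear x y y = false).
Proof. by split; [split|]; apply/negP=> /collinear_neq[]; rewrite eqxx. Qed.

Lemma line_swap12 a b c d : line a b c d = line b a c d.
Proof. by rewrite /line [[set a; b]]setUC. Qed.

Lemma line_swap23 a b c d : line a b c d = line a c b d.
Proof. by rewrite /line [_ :|: [set c]]setUAC. Qed.

Lemma line_swap34 a b c d : line a b c d = line a b d c.
Proof. by rewrite /line setUAC. Qed.

(* Triples with a repeated point are not collinear, so the parity condition
   extends to quadruples with repetitions. *)
Lemma regular_two_graph_cocycle w x y z :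
  regular_two_graph (collinear_triples blocks) ->
  collinear x y z = collinear w y z (+) collinear w x z (+) collinear w x y.
Proof.
case=> card3 [_ even4].
have [uniq_s|] := boolP (uniq [:: w; x; y; z]); last first.
  rewrite /= !inE !negb_or andbT !negb_and !negbK -!orbA.
  do ?[case/orP]; move/eqP->; rewrite !collinear_irr ?addbF ?addbb ?addFb //.
  - by rewrite collinear_swap12.
  - by rewrite [RHS]collinear_rot.
  - by rewrite collinear_swap23 addbb.
set s := [:: w; x; y; z] in uniq_s; set C := collinear_triples blocks.
have card_s : #|[set:: s]| = 4 by apply/eqP; rewrite card_set_seq.
have := even4 [set:: s] card_s; rewrite (card_facets card3 card_s).
have -> : \sum_(u in [set:: s]) ([set:: s] :\ u \in C)
        = \sum_(u <- s) ([set:: s] :\ u \in C).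
  by rewrite [RHS]big_uniq //; apply: eq_bigl => u; rewrite inE.
have := uniq_s; rewrite /= !inE !negb_or andbT.
case/and3P=> /and3P[/negPf wx /negPf wy /negPf wz].
case/andP=> /negPf xy /negPf xz /negPf yz.
rewrite !big_cons big_nil !set_seqD1 //= !eqxx wx wy wz xy xz yz !set_seq3.
by rewrite -!/(collinear _ _ _); do 4 case: (collinear _ _ _).
Qed.

Section SupersimpleDesign.
Variable lam : nat.
Hypothesis card_line : forall L, L \in blocks -> #|L| = 4.
Hypothesis count_pair : forall a b, a != b ->
  count (fun L => (a \in L) && (b \in L)) blocks = lam.
Hypothesis blocks_supersimple : supersimple blocks.

Lemma supersimple_uniq : uniq blocks.
Proof.
apply/(uniqP set0) => i j; rewrite !inE => lti ltj eq_ij.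
apply/eqP/negPn/negP=> neq_ij; have := blocks_supersimple lti ltj neq_ij.
by rewrite eq_ij setIid card_line ?mem_nth.
Qed.

Lemma supersimple_eq K L :
  K \in blocks -> L \in blocks -> 2 < #|K :&: L| -> K = L.
Proof.
move=> bK bL; rewrite ltnNge; apply: contraNeq => neqKL.
rewrite -[K](nth_index set0 bK) -[L](nth_index set0 bL).
apply: blocks_supersimple; rewrite ?index_mem //.
by apply: contraNneq neqKL => eqKL; rewrite -(nth_index set0 bK) eqKL nth_index.
Qed.

Lemma supersimple_count_has (X : {set T}) : 2 < #|X| ->
  count (fun L => X \subset L) blocks = has (fun L => X \subset L) blocks.
Proof.
move=> X_gt2; case: (boolP (has _ _)) => [/hasP[K bK sXK]|]; last first.
  by rewrite has_count -eqn0Ngt => /eqP.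
transitivity (count_mem K blocks); last first.
  by rewrite count_uniq_mem ?supersimple_uniq ?bK.
apply: eq_in_count => L bL /=; apply/idP/eqP=> [sXL|-> //].
apply: supersimple_eq => //; apply: leq_trans X_gt2 (subset_leq_card _).
exact/subsetIP.
Qed.

Lemma line_uniq a b c d : line a b c d -> uniq [:: a; b; c; d].
Proof. by move/card_line/eqP; rewrite -set_seq4 card_set_seq. Qed.

Lemma line_collinear a b c d : line a b c d -> collinear a b c.
Proof.
move=> line_abcd; rewrite collinearE; apply/andP; split.
  by have := line_uniq line_abcd; rewrite -(rot_uniq 3) => /andP[].
by apply/hasP; exists [set a; b; c; d]; rewrite ?subsetUl.
Qed.

Lemma collinear_line a b c : collinear a b c -> exists d, line a b c d.
Proof.
rewrite collinearE -card_set_seq set_seq3 => /andP[/eqP card_abc].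
case/hasP=> L bL sub_abc.
have [|d _ defL] := subset_card_succ sub_abc.
  by rewrite card_line ?card_abc.
by exists d; rewrite /line setUC -defL.
Qed.

Lemma count_collinear a b z : a != b ->
  count (fun L => (a \in L) && (b \in L) && (z \in L :\ a :\ b)) blocks
    = collinear a b z.
Proof.
move=> ab; rewrite collinearE.
case: (boolP (uniq _)) => [uniq_abz | not_uniq] /=.
  rewrite -supersimple_count_has; last first.
    by move: uniq_abz; rewrite -card_set_seq set_seq3 => /eqP->.
  move: uniq_abz; rewrite /= !inE negb_or andbT => /andP[/andP[_ az] bz].
  apply: eq_count => L; rewrite !inE ![z == _]eq_sym az bz.
  by rewrite !subUset !sub1set.
rewrite -(count_pred0 blocks); apply: eq_count => L /=.
move: not_uniq; rewrite /= !inE andbT negb_or ab /= negb_and !negbK.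
rewrite ![z == _]eq_sym.
by case/orP=> ->; rewrite ?andbF.
Qed.

Lemma card_line_rest L a b :
  L \in blocks -> a != b -> (a \in L) && (b \in L) -> #|L :\ a :\ b| = 2.
Proof.
move=> bL ab /andP[La Lb]; have := card_line bL.
by rewrite (cardsD2 ab La Lb) => -[].
Qed.

Lemma card_collinear a b :
  a != b -> #|[set z | collinear a b z]| = (2 * lam)%N.
Proof.
move=> ab.
transitivity (\sum_(L <- blocks | (a \in L) && (b \in L)) #|L :\ a :\ b|).
  rewrite sum_card_exchange -sum1dep_card big_mkcond; apply: eq_bigr => z _.
  by rewrite count_collinear //; case: collinear.
rewrite -(count_pair ab) -sum1_count mulnC big_distrl /=.
rewrite big_seq_cond [RHS]big_seq_cond.
by apply: eq_bigr => L /andP[bL Lab]; rewrite card_line_rest.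
Qed.

Lemma move_id a : move a a = 1.
Proof. by rewrite /elem_move eqxx. Qed.

Lemma moveE a b x : a != b ->
  move a b x =
    (\prod_(L <- blocks | (a \in L) && (b \in L)) other_pair_perm L a b)
      (tperm a b x).
Proof. by rewrite /elem_move => /negPf->; rewrite permM. Qed.

Lemma prod_other_pair_fix a b x : a != b -> ~~ collinear a b x ->
  (\prod_(L <- blocks | (a \in L) && (b \in L)) other_pair_perm L a b) x = x.
Proof.
move=> ab ncol_abx; apply: prod_perm_fix => L bL Lab.
rewrite other_pair_perm_out ?card_line_rest //; apply: contra ncol_abx => Lx.
rewrite -[collinear _ _ _]lt0b -count_collinear // -has_count.
by apply/hasP; exists L; rewrite ?Lab.
Qed.

Lemma move_left a b : move a b a = b.
Proof.
have [->|ab] := eqVneq a b; first by rewrite move_id perm1.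
by rewrite moveE // tpermL prod_other_pair_fix ?collinear_irr.
Qed.

Lemma move_right a b : move a b b = a.
Proof.
have [->|ab] := eqVneq a b; first by rewrite move_id perm1.
by rewrite moveE // tpermR prod_other_pair_fix ?collinear_irr.
Qed.

Lemma move_noncollinear a b x :
  x != a -> x != b -> ~~ collinear a b x -> move a b x = x.
Proof.
move=> xa xb ncol_abx.
have [->|ab] := eqVneq a b; first by rewrite move_id perm1.
by rewrite moveE // tpermD 1?eq_sym ?prod_other_pair_fix.
Qed.

Lemma move_line a b x y : line a b x y -> move a b x = y.
Proof.
move=> line_abxy; have := line_uniq line_abxy; rewrite /= !inE !negb_or andbT.
case/and3P=> /and3P[ab ax ay] /andP[bx b_y] xy; set L := [set a; b; x; y].
have swap_xy : other_pair_perm L a b = tperm x y.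
  apply: other_pair_permE; rewrite // /L -!setUA.
  by rewrite !setU1K // !inE !negb_or ?ab ?ax ?bx.
have fix_other_line K z : K \in blocks -> (a \in K) && (b \in K) -> K != L ->
    z \in L -> other_pair_perm K a b z = z.
  move=> bK Kab neqKL Lz; rewrite other_pair_perm_out ?card_line_rest //.
  apply: contra neqKL; rewrite !inE => /and3P[zb za Kz].
  apply/eqP/supersimple_eq => //.
  have <- : #|[set a; b; z]| = 3.
    apply/eqP; rewrite -set_seq3 card_set_seq /= !inE negb_or.
    by rewrite ab ![_ == z]eq_sym za zb.
  apply/subset_leq_card; rewrite subsetI !subUset !sub1set Kz Lz Kab !inE.
  by rewrite !eqxx orbT.
rewrite moveE // tpermD //; transitivity (tperm x y x); last by rewrite tpermL.
rewrite -swap_xy; apply: prod_perm_single; rewrite ?supersimple_uniq //.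
  by rewrite !inE !eqxx orbT.
rewrite swap_xy tpermL => K bK Kab neqKL.
by split; apply: fix_other_line; rewrite // !inE eqxx !orbT.
Qed.

Lemma line_move a b x : collinear a b x -> line a b x (move a b x).
Proof. by case/collinear_line=> y line_abxy; rewrite (move_line line_abxy). Qed.

Lemma move_collinear_neq a b x : collinear a b x -> move a b x != x.
Proof. by move/line_move/line_uniq => /and4P[_ _ /=]; rewrite inE eq_sym. Qed.

Lemma afix_moveE a b : a != b ->
  'Fix_'P[move a b] = ~: ([set a; b] :|: [set z | collinear a b z]).
Proof.
move=> ab; apply/setP=> x.
apply/afix1P/idP; rewrite /= apermE !inE !negb_or -andbA; last first.
  by case/and3P; apply: move_noncollinear.
move=> fixx; apply/and3P; split; apply: contra_eqN fixx.
- by move/eqP->; rewrite move_left eq_sym.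
- by move/eqP->; rewrite move_right.
- exact: move_collinear_neq.
Qed.

Lemma card_afix_move a b :
  a != b -> #|'Fix_'P[move a b]| = #|T| - (2 * lam + 2).
Proof.
move=> ab; rewrite afix_moveE // cardsCs setCK cardsU (card_collinear ab).
rewrite cards2 ab (_ : _ :&: _ = set0) ?cards0 ?subn0 1?addnC //.
apply/setP=> x.
by rewrite !inE; apply/negP=> /andP[/orP[]/eqP->]; rewrite collinear_irr.
Qed.

Lemma two_graph_common_noncollinear a b c :
  regular_two_graph (collinear_triples blocks) -> 2 * lam + 2 < #|T| ->
  collinear a b c ->
  exists z, [/\ z != a, ~~ collinear a b z & ~~ collinear a c z].
Proof.
move=> two_graph large col_abc; have [ab ac bc] := collinear_neq col_abc.
suff /exists_inP[z za /norP[ncol_abz ncol_acz]] :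
    [exists z in ~: [set a], ~~ (collinear a b z || collinear a c z)].
  by exists z; rewrite !inE in za.
apply: contraTT large => /exists_inPn all_col; rewrite -leqNgt.
pose N x y := [set z | collinear x y z].
have union : [set~ a] \subset N a b :|: N a c.
  by apply/subsetP=> z /all_col; rewrite negbK !inE.
have inter : N b c \subset a |: N a b :&: N a c.
  apply/subsetP=> z; rewrite !inE; case: eqVneq => //= za.
  rewrite (regular_two_graph_cocycle a b c z two_graph) col_abc addbT.
  have := all_col z; rewrite !inE za => /(_ isT).
  by rewrite negbK; do 2 case: collinear.
have := subset_leq_card union; have := subset_leq_card inter.
have := cardsUI (N a b) (N a c); rewrite !card_collinear // cardsC1 cardsU1.
by case: (_ \notin _) => /=; lia.
Qed.

Section Groupoid.
Variable inf : T.
Hypothesis large : 2 * lam + 2 < #|T|.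

Local Notation groupoid := (conway_groupoid blocks inf).
Local Notation hole := (pi_inf blocks inf).

Lemma move_seq_last a s : move_seq blocks a s a = last a s.
Proof.
by elim: s a => [|b s IHs] a /=; rewrite ?perm1 // permM move_left IHs.
Qed.

Lemma mem_pi_inf s : move_seq blocks inf (rcons s inf) \in hole.
Proof. by rewrite inE; apply/boolp.asboolP; exists s. Qed.

Lemma pi_inf_fix g : g \in hole -> g inf = inf.
Proof.
by rewrite inE => /boolp.asboolP[s ->]; rewrite move_seq_last last_rcons.
Qed.

Lemma mem_conway_groupoid a s : move_seq blocks inf (a :: s) \in groupoid.
Proof. by rewrite inE; apply/boolp.asboolP; exists (a :: s). Qed.

Lemma conway_groupoid_fix_pi_inf g :
  g \in groupoid -> g inf = inf -> g \in hole.
Proof.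
rewrite inE => /boolp.asboolP[s [s_gt0 ->]]; rewrite move_seq_last.
case/lastP: s s_gt0 => // s x _; rewrite last_rcons => ->.
exact: mem_pi_inf.
Qed.

Lemma conway_groupoid_trans : [transitive groupoid, on [set: T] | 'P].
Proof.
apply/imsetP; exists inf => //; apply/setP=> x; rewrite inE; apply/esym/orbitP.
exists (move_seq blocks inf [:: x]); first exact: mem_conway_groupoid.
by rewrite /= apermE mulg1 move_left.
Qed.

Lemma move_conway_groupoid a b :
  is_group_set groupoid -> move a b \in groupoid.
Proof.
case=> _ [mulG invG]; have := mem_conway_groupoid a [:: b].
have /invG Ga := mem_conway_groupoid a [::].
by move/(mulG _ _ Ga); rewrite /= !mulg1 mulKg.
Qed.

Lemma congruence_move_fix (A : {set {perm T}}) (S : {set T}) (rT : Type)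
    (h : T -> rT) a b x :
  congruence_on A S 'P h -> move a b \in A -> a \in S -> x \in S ->
  move a b x = x -> h x = h a -> h a = h b.
Proof.
move=> h_congr Aab Sa Sx fixx eqxa; have := h_congr _ Aab _ _ Sx Sa eqxa.
by rewrite /= !apermE fixx move_left eqxa.
Qed.

Section GroupoidCongruence.
Variables (rT : eqType) (h : T -> rT).
Hypothesis groupoid_group : is_group_set groupoid.
Hypothesis h_congr : congruence_on groupoid [set: T] 'P h.

Let h_move a b x y : h x = h y -> h (move a b x) = h (move a b y).
Proof. exact: (h_congr (move_conway_groupoid a b _)). Qed.

Let h_move_fix a b x : move a b x = x -> h x = h a -> h a = h b.
Proof. exact: (congruence_move_fix h_congr (move_conway_groupoid a b _)). Qed.

Lemma afix_move_sub_class d e :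
  d != e -> h d = h e -> 'Fix_'P[move d e] \subset [set x | h x == h d].
Proof.
move=> de eqde; apply/subsetP=> x; rewrite inE => /afix1P.
apply: contra_eqT => neqxd; rewrite /= apermE.
apply: move_collinear_neq; rewrite collinear_swap23.
apply: contraNT neqxd => ncol_dxe.
have [<-|ex] := eqVneq e x; first by rewrite eqde.
suff fixe : move d x e = e by rewrite (h_move_fix fixe).
by apply: move_noncollinear; rewrite // eq_sym.
Qed.

Lemma class_sub_afix_move a b d :
  h a != h b -> h a != h d -> h b != h d -> move a b d = d ->
  [set x | h x == h d] \subset 'Fix_'P[move a b].
Proof.
move=> neqab neqad neqbd fixd; apply/subsetP=> x; rewrite inE => /eqP eqxd.
have xa : x != a by apply: contraNneq neqad => <-; rewrite eqxd.
have xb : x != b by apply: contraNneq neqbd => <-; rewrite eqxd.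
apply/afix1P; rewrite /= apermE; apply: move_noncollinear => //.
apply: contraNN neqab => /line_move; set y := move a b x => line_abxy.
have eqyx : h y = h x by rewrite /y (h_move a b eqxd) fixd.
have line_xayb : line x a y b.
  by rewrite line_swap34 line_swap12 line_swap23.
by have := h_move x a eqyx; rewrite (move_line line_xayb) move_left => ->.
Qed.

Lemma groupoid_congruence_constant d e a : d != e -> h d = h e -> h a = h d.
Proof.
move=> de eqde; apply/eqP/negPn/negP=> neqad.
have da : d != a by apply: contraNneq neqad => ->.
have [b] : exists b, b \in 'Fix_'P[move d a].
  by apply/set0Pn; rewrite -card_gt0 card_afix_move // subn_gt0.
rewrite afix_moveE // !inE !negb_or -andbA => /and3P[bd ba ncol_dab].
have fixb : move d a b = b by apply: move_noncollinear.
have fixd : move a b d = d.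
  by apply: move_noncollinear; rewrite // 1?eq_sym // -collinear_rot.
have neqbd : h b != h d.
  by apply: contraNneq neqad => eqbd; rewrite (h_move_fix fixb eqbd).
have neqab : h a != h b.
  apply: contraNneq neqbd => /esym eqba.
  by have := h_move d a eqba; rewrite fixb move_right => ->.
have class_fixed := class_sub_afix_move neqab neqad neqbd fixd.
have fixed_class : 'Fix_'P[move d e] \subset [set x | h x == h d] :\ d.
  rewrite subsetD1 afix_move_sub_class //=; apply: contra de => /afix1P.
  by rewrite /= apermE move_left => ->.
have fewer : 'Fix_'P[move d e] \proper 'Fix_'P[move a b].
  apply/(sub_proper_trans fixed_class)/proper_sub_trans/class_fixed.
  by apply: properD1; rewrite inE.
by have := proper_card fewer; rewrite !card_afix_move // 1?eq_sym // ltnn.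
Qed.

End GroupoidCongruence.

Lemma conway_groupoid_primitive :
  is_group_set groupoid -> [primitive groupoid, on [set: T] | 'P].
Proof.
move=> grp; apply: primitive_congruence conway_groupoid_trans _.
move=> h h_congr d e _ _ de eqde x _.
exact: (groupoid_congruence_constant grp h_congr _ de eqde).
Qed.

Definition loop a b : {perm T} := move_seq blocks inf [:: a; b; inf].

Lemma loopE a b x : loop a b x = move b inf (move a b (move inf a x)).
Proof. by rewrite /loop /= mulg1 !permM. Qed.

Lemma loop_pi_inf a b : loop a b \in hole.
Proof. exact: (mem_pi_inf [:: a; b]). Qed.

Lemma loop_collinear a b : collinear inf a b -> loop a b b = b.
Proof.
move/line_move; rewrite loopE; set c := move inf a b => line_iabc.
have line_abci : line a b c inf.
  by rewrite line_swap34 line_swap23 line_swap12.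
by rewrite (move_line line_abci) move_right.
Qed.

Lemma loop_line a b x y :
  line a b x y -> x != inf -> y != inf ->
  ~~ collinear inf a x -> ~~ collinear inf b y -> loop a b x = y.
Proof.
move=> line_abxy xi yi ncol_ax ncol_by; have := line_uniq line_abxy.
rewrite /= !inE !negb_or => /and3P[/and3P[_ ax _] /andP[_ b_y] _].
rewrite loopE (move_noncollinear xi _ ncol_ax) 1?eq_sym //.
rewrite (move_line line_abxy) move_noncollinear // 1?collinear_swap12 //.
by rewrite eq_sym.
Qed.

Lemma move_noncollinear_inf a b :
  a != inf -> b != inf -> ~~ collinear inf a b -> move a b inf = inf.
Proof.
move=> ai bi; rewrite collinear_rot => ncol_ab.
by rewrite move_noncollinear // eq_sym.
Qed.

Section TwoGraph.
Hypothesis two_graph : regular_two_graph (collinear_triples blocks).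

Let cocycle x y z :
  collinear x y z =
    collinear inf y z (+) collinear inf x z (+) collinear inf x y.
Proof. exact: regular_two_graph_cocycle. Qed.

Lemma noncollinear_path x y : x != inf -> y != inf ->
  exists z, [/\ z != inf, ~~ collinear inf x z & ~~ collinear inf z y].
Proof.
move=> xi yi; have [col_xy | ncol_xy] := boolP (collinear inf x y); last first.
  by exists x; rewrite collinear_irr.
have [z [zi ncol_xz ncol_yz]] :=
  two_graph_common_noncollinear two_graph large col_xy.
by exists z; rewrite [collinear inf z y]collinear_swap23.
Qed.

Lemma pi_inf_trans : [transitive hole, on [set~ inf] | 'P].
Proof.
have [x xi] : exists x, x \in [set~ inf].
  by apply/set0Pn; rewrite -card_gt0 cardsC1; lia.
apply/imsetP; exists x => //; apply/setP=> y; rewrite !inE in xi *.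
apply/idP/orbitP=> [yi|[g hole_g <-]]; last first.
  by rewrite /= apermE -(pi_inf_fix hole_g) (inj_eq perm_inj).
have [z [zi ncol_xz ncol_zy]] := noncollinear_path xi yi.
exists (move_seq blocks inf (rcons [:: x; z; y] inf)); first exact: mem_pi_inf.
rewrite /= apermE mulg1 !permM move_right (move_noncollinear_inf xi zi) //.
by rewrite (move_noncollinear_inf zi yi) // move_right.
Qed.

Section PiInfCongruence.
Variables (rT : eqType) (h : T -> rT).
Hypothesis groupoid_group : is_group_set groupoid.
Hypothesis h_congr : congruence_on hole [set~ inf] 'P h.

Definition separated a b : bool :=
  [&& a != inf, b != inf, h a != h b & ~~ collinear inf a b].

Lemma separatedC a b : separated a b = separated b a.
Proof. by rewrite /separated andbCA collinear_swap23 [h a == _]eq_sym. Qed.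

Lemma separated_exists x y : x != inf -> y != inf -> h x != h y ->
  exists a b, separated a b /\ h a = h x.
Proof.
move=> xi yi neqxy; have [z [zi ncol_xz ncol_zy]] := noncollinear_path xi yi.
have [eqxz | neqxz] := eqVneq (h x) (h z).
  by exists z, y; rewrite /separated zi yi -eqxz neqxy.
by exists x, z; rewrite /separated xi zi neqxz.
Qed.

Lemma move_separated_pi_inf a b : separated a b -> move a b \in hole.
Proof.
case/and4P=> ai bi _ ncol_ab; apply: conway_groupoid_fix_pi_inf.
  exact: move_conway_groupoid.
exact: move_noncollinear_inf.
Qed.

Lemma separated_collinear a b c :
  separated a b -> c != inf -> c != a -> h c = h a -> collinear a b c.
Proof.
move=> sep_ab ci ca eqca; have [ai bi neqab _] := and4P sep_ab.
apply: contraNT neqab => ncol_abc; apply/eqP.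
have [<-|cb] := eqVneq c b; first by rewrite eqca.
have fixc := move_noncollinear ca cb ncol_abc.
have move_ab := move_separated_pi_inf sep_ab.
by apply: (congruence_move_fix h_congr move_ab) fixc eqca; rewrite in_setC1.
Qed.

Lemma separated_noncollinear a b c :
  separated a b -> c != inf -> h c = h a -> ~~ collinear inf a c.
Proof.
move=> sep_ab ci eqca; have [ai bi neqab ncol_ab] := and4P sep_ab.
apply/negP=> col_ac.
have ca : c != a by have [_ _] := collinear_neq col_ac; rewrite eq_sym.
have [z [za ncol_aiz ncol_acz]] : exists z,
    [/\ z != a, ~~ collinear a inf z & ~~ collinear a c z].
  by apply: two_graph_common_noncollinear; rewrite // collinear_swap12.
have ncol_az : ~~ collinear inf a z by rewrite collinear_swap12.
have zi : z != inf by apply: contraNneq ncol_acz => ->; rewrite -collinear_rot.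
have zc : z != c by apply: contraNneq ncol_aiz => ->; rewrite collinear_swap12.
have eqza : h z = h a.
  apply/eqP; apply: contraNT ncol_acz => neqza; rewrite collinear_swap23.
  by apply: separated_collinear; rewrite // /separated ai zi eq_sym neqza.
have col_abc := separated_collinear sep_ab ci ca eqca.
have col_abz := separated_collinear sep_ab zi za eqza.
have ncol_cb : ~~ collinear inf c b.
  move: col_abc; rewrite cocycle col_ac (negPf ncol_ab) collinear_swap23.
  by case: collinear.
have col_cbz : collinear c b z.
  by apply: separated_collinear; rewrite ?eqca // /separated ci bi eqca neqab.
move: ncol_acz col_abz col_cbz.
rewrite (cocycle a c z) (cocycle a b z) (cocycle c b z).
rewrite col_ac (negPf ncol_ab) (negPf ncol_cb) (negPf ncol_az).
by do 2 case: collinear.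
Qed.

Lemma separated_singleton a b c :
  separated a b -> c != inf -> h c = h a -> c = a.
Proof.
move=> sep_ab ci eqca; have [ai bi neqab ncol_ab] := and4P sep_ab.
apply/eqP; apply: contraNT neqab => ca.
have move_ab := move_separated_pi_inf sep_ab.
have := line_move (separated_collinear sep_ab ci ca eqca).
set d := move a b c => line_abcd.
have line_adbc : line a d b c by rewrite line_swap23 line_swap34.
have di : d != inf by rewrite -(pi_inf_fix move_ab) (inj_eq perm_inj).
have eqdb : h d = h b.
  have := h_congr move_ab _ _ eqca; rewrite /= !apermE move_left.
  by apply; rewrite in_setC1.
have ncol_ac := separated_noncollinear sep_ab ci eqca.
have ncol_bd : ~~ collinear inf b d.
  by apply: separated_noncollinear di eqdb; rewrite separatedC; apply: sep_ab.
have col_ad : collinear inf a d.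
  have : collinear a b d.
    by apply: (@line_collinear _ _ _ c); rewrite line_swap34.
  by rewrite cocycle (negPf ncol_ab) (negPf ncol_bd) addbF.
have ncol_dc : ~~ collinear inf d c.
  have : collinear a d c.
    by apply: (@line_collinear _ _ _ b); rewrite line_swap34.
  by rewrite cocycle (negPf ncol_ac) col_ad; case: collinear.
have := h_congr (loop_pi_inf a d) _ _ eqdb; rewrite !in_setC1 /= !apermE.
rewrite loop_collinear // (loop_line line_adbc) // => /(_ di bi) eqdc.
by rewrite -eqca -eqdc eqdb.
Qed.

Lemma pi_inf_congruence_constant d e x :
  d != inf -> e != inf -> x != inf -> d != e -> h d = h e -> h x = h d.
Proof.
move=> di ei xi de eqde; apply/eqP; apply: contraNT de; rewrite eq_sym => neqdx.
have [a [b [sep_ab eqad]]] := separated_exists di xi neqdx.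
have singleton c : c != inf -> h c = h d -> c = a.
  by rewrite -eqad; apply: separated_singleton sep_ab.
by rewrite (singleton d) // (singleton e).
Qed.

End PiInfCongruence.

Lemma pi_inf_primitive :
  is_group_set groupoid -> [primitive hole, on [set~ inf] | 'P].
Proof.
move=> grp; apply: primitive_congruence pi_inf_trans _.
move=> h h_congr d e + + de eqde x; rewrite !inE => di ei xi.
exact: (pi_inf_congruence_constant grp h_congr di ei).
Qed.

End TwoGraph.
End Groupoid.
End SupersimpleDesign.
End Designs.

Theorem theoremA (T : finType) (blocks : seq {set T}) (lam : nat) (inf : T) :
  is_2design4 blocks lam -> supersimple blocks -> 2 * lam + 2 < #|T| ->
  [/\ (is_group_set (conway_groupoid blocks inf) ->
         [primitive conway_groupoid blocks inf, on [set: T] | 'P]),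
      (regular_two_graph (collinear_triples blocks) ->
         [transitive pi_inf blocks inf, on [set~ inf] | 'P]) &
      (regular_two_graph (collinear_triples blocks) ->
       is_group_set (conway_groupoid blocks inf) ->
         [primitive pi_inf blocks inf, on [set~ inf] | 'P])].
Proof.
case=> card_line count_pair ss large; split.
- exact: (conway_groupoid_primitive card_line count_pair ss large).
- exact: (pi_inf_trans card_line count_pair ss inf large).
- exact: (pi_inf_primitive card_line count_pair ss large).
Qed.
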